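(* Let $f,g:\mathbb{R}^n\to[0,\infty)$ be measurable. Suppose there exist $s_0>0$ and a map $T:\mathbb{R}^n\to\mathbb{R}^n$ such that $T$ is a change of variables from $g^{s_0}$ to $f^{s_0}$, with $|T'(x)|\le 1$ (for Lebesgue almost every $x$), and $\int g^{s_0}(x)\,dx=\int f^{s_0}(x)\,dx<\infty$. Then $$\int g^s(x)\,dx\le\int f^s(x)\,dx\qquad\text{for all } s\ge s_0 .$$
   Context: $|T'(x)|$ is the absolute value of the determinant of the derivative of $T$ at $x$. Given measurable $\alpha,\beta:\mathbb{R}^n\to[0,\infty)$ with $\int\alpha(x)\,dx<\infty$, a map $T:\mathbb{R}^n\to\mathbb{R}^n$ is a change of variables from $\alpha$ to $\beta$ if $T$ is locally Lipschitz, injective, and $\alpha(x)=\beta(T(x))|T'(x)|$ for Lebesgue almost every $x$. Integrals are over $\mathbb{R}^n$ and may take the value $+\infty$. *)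

(* Defs.v *)
From HB Require Import structures.
From mathcomp Require Import all_boot all_order all_algebra.
From mathcomp Require Import all_classical all_reals all_analysis.

Set Implicit Arguments.
Unset Strict Implicit.
Unset Printing Implicit Defensive.

Import Order.TTheory GRing.Theory Num.Theory.
Import numFieldNormedType.Exports.

Local Open Scope classical_set_scope.
Local Open Scope ring_scope.

Section lebesgue_outer_measure.
Context {R : realType} {n : nat}.
Implicit Types (p : 'rV[R]_n * 'rV[R]_n) (A : set 'rV[R]_n).

Definition box p : set 'rV[R]_n :=
  [set x | forall i, p.1 0 i < x 0 i <= p.2 0 i].

(* The maximum gives empty boxes volume 0. *)
Definition box_volume p : R := \prod_(i < n) Num.max 0 (p.2 0 i - p.1 0 i).

(* Covers are countable, possibly finite or empty, families of boxes; infinite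
   sequences would not do for n = 0, where every box has volume 1. *)
Definition box_cover A : set (set ('rV[R]_n * 'rV[R]_n)) :=
  [set D | countable D /\ A `<=` \bigcup_(p in D) box p].

Definition lebesgue_outer A : \bar R :=
  ereal_inf [set \esum_(p in D) (box_volume p)%:E | D in box_cover A].

Lemma box_volume_ge0 p : 0 <= box_volume p.
Proof. by apply: prodr_ge0 => i _; rewrite le_max lexx. Qed.

Local Open Scope ereal_scope.

Let esum_volume_ge0 (D : set ('rV[R]_n * 'rV[R]_n)) :
  0 <= \esum_(p in D) (box_volume p)%:E.
Proof. by apply: esum_ge0 => p _; rewrite lee_fin box_volume_ge0. Qed.

Lemma lebesgue_outer_ge0 A : 0 <= lebesgue_outer A.
Proof. by apply: le_ereal_inf_tmp => _ [D _ <-]; exact: esum_volume_ge0. Qed.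

Lemma lebesgue_outer0 : lebesgue_outer set0 = 0.
Proof.
apply/eqP; rewrite eq_le lebesgue_outer_ge0 andbT.
apply: ereal_inf_lbound; exists set0; last by rewrite esum_set0.
by split; [exact: countable0 | move=> x].
Qed.

Lemma le_lebesgue_outer : {homo lebesgue_outer : A B / A `<=` B >-> A <= B}.
Proof.
move=> A B AB; apply: ereal_inf_le_tmp => _ [D [cD BD] <-].
by exists D => //; split => //; exact: subset_trans BD.
Qed.

Lemma lebesgue_outer_sigma_subadditive : sigma_subadditive lebesgue_outer.
Proof.
move=> A; have [[i ioo]|] := pselect (exists i, lebesgue_outer (A i) = +oo).
  rewrite (eseries_pinfty _ _ ioo) ?leey// => k _.
  by rewrite -ltNye (lt_le_trans _ (lebesgue_outer_ge0 _)).
rewrite -forallNE => Aoo.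
apply/lee_addgt0Pr => _/posnumP[e].
rewrite (le_trans _ (epsilon_trick _ _ _))//; last first.
  by move=> k; exact: lebesgue_outer_ge0.
have /choice[D PD] k : exists D, box_cover (A k) D /\
    \esum_(p in D) (box_volume p)%:E <=
    lebesgue_outer (A k) + (e%:num / (2 ^ k.+1)%:R)%:E.
  have ek : (0 < e%:num / (2 ^ k.+1)%:R :> R)%R by [].
  have fk : lebesgue_outer (A k) \is a fin_num.
    by rewrite ge0_fin_numE ?lebesgue_outer_ge0// ltey; apply/eqP/Aoo.
  have [_ [D cD <-] Dle] := lb_ereal_inf_adherent ek fk.
  by exists D; split => //; exact: ltW.
apply: (@le_trans _ _ (\esum_(p in \bigcup_k D k) (box_volume p)%:E)).
  apply: ereal_inf_lbound; exists (\bigcup_k D k) => //; split.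
    by apply: bigcup_countable => // k _; exact: (PD k).1.1.
  move=> x [k _] /(PD k).1.2[p Dp px].
  by exists p => //; exists k.
rewrite seqDU_bigcup_eq nneseries_sum_bigcup//; last first.
  by move=> p; rewrite lee_fin box_volume_ge0.
apply: lee_nneseries => [k _ _|k _]; first exact: esum_volume_ge0.
apply: le_trans (PD k).2.
rewrite esum_mkcond [leRHS]esum_mkcond; apply: le_esum => p _.
case: ifPn => [|_]; last by case: ifPn => // _; rewrite lee_fin box_volume_ge0.
by rewrite inE => Dp; rewrite mem_set//; exact: subset_seqDU Dp.
Qed.

HB.instance Definition _ := isOuterMeasure.Build R 'rV[R]_n lebesgue_outer
  lebesgue_outer0 lebesgue_outer_ge0 le_lebesgue_outer
  lebesgue_outer_sigma_subadditive.

End lebesgue_outer_measure.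

(* R^n with its Lebesgue (not merely Borel) measurable sets. *)
Notation Rn R n := (caratheodory_type (@lebesgue_outer R n)).

Definition lebesgue_measure_Rn (R : realType) (n : nat) : set (Rn R n) -> \bar R :=
  lebesgue_outer.

HB.instance Definition _ (R : realType) (n : nat) :=
  isMeasure.Build _ (Rn R n) R (@lebesgue_measure_Rn R n)
    (caratheodory_measure0 _) (@caratheodory_measure_ge0 _ _ _)
    (@caratheodory_measure_sigma_additive _ _ _).

Definition locally_lipschitz (R : realType) (n : nat)
    (T : 'rV[R]_n -> 'rV[R]_n) : Prop :=
  forall x : 'rV[R]_n, exists2 U, nbhs x U & [lipschitz T y | y in U].

(* jacobian uses the library's total differential, which is a default value at
   points where T is not differentiable; for locally Lipschitz T these points
   form a null set by Rademacher's theorem, so they do not affect statements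
   holding almost everywhere. *)
Definition abs_det_deriv (R : realType) (n : nat)
    (T : 'rV[R]_n -> 'rV[R]_n) (x : 'rV[R]_n) : R := `|\det (jacobian T x)|.

Definition change_of_variables (R : realType) (n : nat)
    (alpha beta : 'rV[R]_n -> R) (T : 'rV[R]_n -> 'rV[R]_n) : Prop :=
  [/\ locally_lipschitz T, injective T &
      {ae @lebesgue_measure_Rn R n,
        forall x, alpha x = beta (T x) * abs_det_deriv T x}].

(* Main.v *)
Require Import Defs.
From mathcomp Require Import all_boot all_order all_algebra fingroup perm.
From mathcomp Require Import all_classical all_reals all_analysis.
From mathcomp Require Import measurable_realfun ring lra.

(* Let h = f^s and G = g^s.  Since |T'| <= 1 and s >= s0, the relation
   g^s0 = (f^s0 o T) |T'| gives G <= (h o T) |T'| almost everywhere, so it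
   suffices that int (h o T) |T'| <= int h, the easy half of the area formula
   for injective maps.  Fix r < 1.  Near a point where T' = J is invertible,
   and for a rational matrix L close to J, r |(y - x) L| <= |T y - T x|; hence
   {G > 0} is covered, up to a null set, by countably many measurable pieces on
   which this holds for all pairs of points, on which h o T >= a for a constant
   a, and on which r^2 G <= a |det L|.  On such a piece L o T^-1 is
   1/r-Lipschitz, so the scaling of outer measure under linear and under
   Lipschitz maps (exact for the sup norm, whose balls are cubes) gives
   r^n |det L| lambda(A) <= lambda(T A), and therefore
   r^(n+2) int_A G <= int_{T A} h.  The images of disjoint pieces are disjoint
   and measurable, so summing over the pieces and letting r tend to 1 concludes.

   Rademacher's theorem is not needed: at a point where T is not differentiable
   the library's differential is the zero map, so G = 0 there (for n = 0 every
   map is differentiable). *)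

Set Implicit Arguments.
Unset Strict Implicit.
Unset Printing Implicit Defensive.

Import Order.TTheory GRing.Theory Num.Theory.
Import numFieldNormedType.Exports.

Local Open Scope classical_set_scope.
Local Open Scope ring_scope.

Local Notation "'\lam' A" := (@lebesgue_outer _ _ A) (at level 10, A at level 8).

(** * Countable sums and countable subadditivity *)

Lemma le_esumZl (R : realType) (T : choiceType) (D : set T) (c : R)
    (a : T -> \bar R) : 0 <= c -> (forall x, 0 <= a x)%E ->
  (\esum_(x in D) (c%:E * a x) <= c%:E * \esum_(x in D) a x)%E.
Proof.
move=> c0 a0; apply: ge_ereal_sup => _ [F [finF FD] <-].
rewrite -ge0_mule_fsumr//; apply: lee_wpmul2l; rewrite ?lee_fin//.
by apply: ereal_sup_ubound; exists F.
Qed.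

(** Covers are indexed by countable sets, sigma-subadditivity by [nat]. An injection of [D] into
    [nat] turns the family into a sequence, with the empty set at the numbers it misses. *)
Lemma outer_measure_countable_bigcup (R : realType) (T U : choiceType)
    (mu : {outer_measure set T -> \bar R}) (D : set U) (A : U -> set T) :
  countable D ->
  (mu (\bigcup_(u in D) A u) <= \esum_(u in D) mu (A u))%E.
Proof.
move=> /countable_injP[/= f]; set g : U -> nat := f => /= ginj.
pose B k := \bigcup_(u in D `&` [set u | g u = k]) A u.
have BE u : D u -> B (g u) = A u.
  move=> Du; apply/seteqP; split => [x [v [Dv /= gvu] Avx]|x Aux]; last by exists u.
  by rewrite -(ginj _ _ _ _ gvu) ?inE.
rewrite (_ : \bigcup_(u in D) A u = \bigcup_k B k); last first.
  apply/seteqP; split => [x [u Du Aux]|x [k _ [u [Du _]] Aux]]; last by exists u.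
  by exists (g u) => //; exists u.
apply: le_trans (outer_measure_sigma_subadditive mu B) _.
rewrite nneseries_esumT; last by move=> k; exact: outer_measure_ge0.
rewrite (_ : \esum_(i in _) _ = \esum_(k in g @` D) mu (B k)).
  rewrite esum_image//; apply: le_esum => u Du; rewrite BE//.
rewrite [RHS]esum_mkcond; apply: eq_esum => k _.
case: ifPn => //; rewrite notin_setE => /= nk.
rewrite (_ : B k = set0) ?outer_measure0// -subset0 => x [u [Du gu] _].
by apply: nk; exists u.
Qed.

(** * Boxes *)

Section boxes.
Context {R : realType} {n : nat}.
Implicit Types (p : 'rV[R]_n * 'rV[R]_n) (A E : set 'rV[R]_n) (x : 'rV[R]_n).

Lemma lebesgue_outer_box p : (\lam (box p) <= (box_volume p)%:E)%E.
Proof.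
apply: ereal_inf_lbound; exists [set p].
  by split; [exact: countable1|move=> x px; exists p].
by rewrite esum_set1// lee_fin box_volume_ge0.
Qed.

(** Bounds on boxes pass to arbitrary sets by taking images of the boxes of a cover and then the
    infimum over covers. The set [E] is where [F] is controlled, and need not be measurable. *)
Lemma lebesgue_outer_image_le (F : 'rV[R]_n -> 'rV[R]_n) (c : R) E :
  0 < c ->
  (forall p, \lam (F @` (box p `&` E)) <= (c * box_volume p)%:E)%E ->
  forall A, (\lam (F @` (A `&` E)) <= c%:E * \lam A)%E.
Proof.
move=> c0 FE A; rewrite [\lam A]/lebesgue_outer -ereal_inf_pZl//.
apply: le_ereal_inf_tmp => _ [_ [D [cD AD] <-] <-].
apply: le_trans; last first.
  by apply: le_esumZl; [exact: ltW|move=> p; rewrite lee_fin box_volume_ge0].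
apply: le_trans; last first.
  by apply: le_esum => p _; rewrite -EFinM; exact: FE.
apply: le_trans; last exact: outer_measure_countable_bigcup.
apply: le_outer_measure => _ [x [/AD[p Dp px] Ex] <-].
by exists p => //; exists x.
Qed.

Definition upd x i (v : R) : 'rV[R]_n := \row_k (if k == i then v else x 0 k).

Lemma updE x i v k : upd x i v 0 k = if k == i then v else x 0 k.
Proof. by rewrite mxE. Qed.

Lemma upd_id x i : upd x i (x 0 i) = x.
Proof. by apply/rowP => k; rewrite updE; case: eqP => [->|]. Qed.

Definition box_upd p i (a b : R) := (upd p.1 i a, upd p.2 i b).

Lemma box_updP p i a b x : box (box_upd p i a b) x <->
  a < x 0 i <= b /\ (forall k, k != i -> p.1 0 k < x 0 k <= p.2 0 k).
Proof.
rewrite /box/=; split=> [xb|[xi xk] k]; last first.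
  by rewrite !updE; case: eqVneq => [->|/xk].
split; first by have := xb i; rewrite !updE eqxx.
by move=> k ki; have := xb k; rewrite !updE (negbTE ki).
Qed.

Lemma box_upd_id p i : box_upd p i (p.1 0 i) (p.2 0 i) = p.
Proof. by rewrite /box_upd !upd_id; case: p. Qed.

(** The (n-1)-dimensional volume of a face orthogonal to the axis [i]. *)
Definition box_face p i : R :=
  \prod_(k < n | k != i) Num.max 0 (p.2 0 k - p.1 0 k).

Lemma box_face_ge0 p i : 0 <= box_face p i.
Proof. by apply: prodr_ge0 => k _; rewrite le_max lexx. Qed.

Lemma box_volume_upd p i a b :
  box_volume (box_upd p i a b) = Num.max 0 (b - a) * box_face p i.
Proof.
rewrite /box_volume (bigD1 i)//= !updE eqxx; congr (_ * _).
by apply: eq_bigr => k ki; rewrite !updE (negbTE ki).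
Qed.

Lemma box_volumeE p i :
  box_volume p = Num.max 0 (p.2 0 i - p.1 0 i) * box_face p i.
Proof. by rewrite -{1}[p](box_upd_id p i) box_volume_upd. Qed.

Lemma box_setI_le p i t : box p `&` [set x | x 0 i <= t] =
  box (box_upd p i (p.1 0 i) (Num.min (p.2 0 i) t)).
Proof.
apply/seteqP; split => x.
  move=> [px /= xt]; apply/box_updP; split; last by move=> k _; exact: px.
  by rewrite le_min xt andbT; exact: px.
move=> /box_updP[]; rewrite le_min => /and3P[px xp xt] xk; split => // k.
by have [->|/xk//] := eqVneq k i; rewrite px.
Qed.

Lemma box_setI_gt p i t : box p `&` [set x | t < x 0 i] =
  box (box_upd p i (Num.max (p.1 0 i) t) (p.2 0 i)).
Proof.
apply/seteqP; split => x.
  move=> [px /= xt]; apply/box_updP; split; last by move=> k _; exact: px.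
  by rewrite gt_max xt andbT; exact: px.
move=> /box_updP[]; rewrite gt_max => /andP[/andP[px xt] xp] xk; split => // k.
by have [->|/xk//] := eqVneq k i; rewrite px.
Qed.

(** The hyperplane cuts each box of a cover of [X] into two half-open boxes whose volumes add up to
    at most its own, so a cover of [X] splits into covers of both parts of [X]. *)
Lemma halfspace_caratheodory i t :
  (@lebesgue_outer R n).-caratheodory [set x : 'rV[R]_n | x 0 i <= t].
Proof.
set H := [set x | _]; have HC : ~` H = [set x : 'rV[R]_n | t < x 0 i].
  by apply/seteqP; split => x /=; rewrite ltNge => /negP.
apply: le_caratheodory_measurable => X; rewrite HC.
apply: le_ereal_inf_tmp => _ [D [cD XD] <-].
have sub Y : (\lam (X `&` Y) <= \esum_(p in D) \lam (box p `&` Y))%E.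
  apply: le_trans; last exact: outer_measure_countable_bigcup.
  by apply: le_outer_measure => x [/XD[p Dp px] Yx]; exists p.
apply: le_trans (leeD (sub _) (sub _)) _.
rewrite -esumD; try by move=> *; exact: outer_measure_ge0.
apply: le_esum => p _; rewrite box_setI_le box_setI_gt.
apply: le_trans (leeD (lebesgue_outer_box _) (lebesgue_outer_box _)) _.
rewrite -EFinD lee_fin !box_volume_upd (box_volumeE p i) -mulrDl.
apply: ler_wpM2r; first exact: box_face_ge0.
rewrite /Num.max/Num.min; do ! case: ifP; lra.
Qed.

(* The box is cut into at most (b - a) / d + 1 slices of width d. *)
Lemma box_slicing (F : 'rV[R]_n -> 'rV[R]_n) E p i (d C : R) : 0 < d -> 0 <= C ->
  (forall a, \lam (F @` (box (box_upd p i a (a + d)) `&` E)) <= (C * d)%:E)%E ->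
  forall a b,
    (\lam (F @` (box (box_upd p i a b) `&` E)) <= (C * (Num.max 0 (b - a) + d))%:E)%E.
Proof.
move=> d0 C0 Fd a b.
have slices m : forall a b, b - a <= m%:R * d ->
    (\lam (F @` (box (box_upd p i a b) `&` E)) <= (C * (m%:R * d))%:E)%E.
  elim: m => [|m IH] {}a {}b ab.
    rewrite (_ : box _ = set0).
      by rewrite set0I image_set0 outer_measure0 lee_fin mul0r mulr0.
    rewrite -subset0 => x /box_updP[/andP[ax xb] _].
    by move: ab; rewrite mul0r subr_le0 leNgt (lt_le_trans ax xb).
  apply: (@le_trans _ _ (\lam (F @` (box (box_upd p i a (a + d)) `&` E)) +
    \lam (F @` (box (box_upd p i (a + d) b) `&` E)))%E).
    apply: le_trans; last exact: outer_measureU2.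
    rewrite -image_setU -setIUl; apply: le_outer_measure; apply: image_subset.
    apply: setSI => x /box_updP[/andP[ax xb] xk].
    have [xd|dx] := leP (x 0 i) (a + d); [left|right]; apply/box_updP;
      by split => //; apply/andP.
  have := leeD (Fd a) (IH (a + d) b _); rewrite -EFinD.
  rewrite (_ : C * d + _ = C * (m.+1%:R * d)); last by rewrite -natr1; ring.
  by apply; move: ab; rewrite -natr1; lra.
have [ba|ab] := leP b a.
  have := slices 0%N a b; rewrite mul0r mulr0 subr_le0 => /(_ ba)/le_trans; apply.
  by rewrite lee_fin mulr_ge0// addr_ge0 ?le_max ?lexx// ltW.
have ba0 : 0 <= (b - a) / d by apply: divr_ge0; rewrite ?subr_ge0 ltW.
have /andP[trunc_le lt_trunc] := truncn_itv ba0.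
apply: le_trans (slices (Num.truncn ((b - a) / d)).+1 _ _ _) _.
  by rewrite -ler_pdivrMr// ltW.
have -> : Num.max 0 (b - a) = b - a by rewrite max_r// subr_ge0 ltW.
rewrite lee_fin ler_wpM2l// -natr1 mulrDl mul1r lerD2r.
by rewrite -ler_pdivlMr.
Qed.

(** Continuity of polynomials at 0. The slicing bounds below depend polynomially on the width [d] of
    the slices, and this lemma lets [d] tend to 0 in them. *)
Lemma lee_poly_limit (p : {poly R}) (X : \bar R) :
  (forall d : R, (0 < d)%R -> X <= p.[d]%:E)%E -> (X <= p.[0]%:E)%E.
Proof.
move=> Xp; apply/lee_addgt0Pr => e e0.
have /cvgrPdist_lt/(_ e e0) := @continuous_horner _ p 0.
move=> /nbhs_ballP[d /= d0] /(_ (d / 2)).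
rewrite /ball/= sub0r normrN gtr0_norm ?divr_gt0// => /(_ _) pd.
apply: le_trans (Xp (d / 2) _) _; first by rewrite divr_gt0.
rewrite -EFinD lee_fin; have := pd _; rewrite ltr_norml; last by lra.
Qed.

Definition addc (c : R) (j i : 'I_n) x := upd x j (x 0 j + c * x 0 i).

(** On a slice of width [d] in coordinate [i], the shear moves coordinate [j] by an amount that
    varies by at most [|c| d], so the image fits in a box whose side [j] is longer by that much.
    This excess vanishes with [d]. *)
Lemma lebesgue_outer_addc_box c (j i : 'I_n) p : j != i ->
  (\lam (addc c j i @` box p) <= (box_volume p)%:E)%E.
Proof.
move=> ji; pose rest := \prod_(k < n | (k != i) && (k != j)) Num.max 0 (p.2 0 k - p.1 0 k).
have rest_ge0 : 0 <= rest by apply: prodr_ge0 => k _; rewrite le_max lexx.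
set w := fun k => Num.max 0 (p.2 0 k - p.1 0 k).
have wj0 k : 0 <= w k by rewrite le_max lexx.
have faceE a b : box_face (box_upd p i a b) i = w j * rest.
  rewrite /box_face (bigD1 j)//= !updE (negbTE ji); congr (_ * _).
  by apply: eq_bigr => k /andP[ki _]; rewrite !updE (negbTE ki).
(* The bound for slices of width [d]: side [j] grows by [|c| d], and slicing side [i] costs at most
   one extra width. *)
pose P : {poly R} := ((w j)%:P + `|c| *: 'X) * rest%:P * ((w i)%:P + 'X).
suff : (\lam (addc c j i @` box p) <= P.[0]%:E)%E.
  rewrite /P !hornerE ?mulr0 ?addr0 (box_volumeE p i).
  by rewrite -[X in box_face X i](box_upd_id p i) faceE mulrC.
apply: lee_poly_limit => d d0.
have -> : P.[d] = (w j + `|c| * d) * rest * (w i + d) by rewrite /P !hornerE.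
rewrite -[X in box X](box_upd_id p i) -[X in _ @` X]setIT.
have C0 : 0 <= (w j + `|c| * d) * rest.
  by apply: mulr_ge0 => //; apply: addr_ge0 => //; apply: mulr_ge0 => //; exact: ltW.
apply: box_slicing => // a; rewrite setIT.
have [pj|pj] := leP (p.2 0 j) (p.1 0 j).
  rewrite (_ : box _ = set0); last first.
    rewrite -subset0 => x /box_updP[_ /(_ j ji)/andP[px xp]].
    by have := lt_le_trans px xp; rewrite ltNge pj.
  rewrite image_set0 outer_measure0 lee_fin.
  exact: mulr_ge0 C0 (ltW d0).
(* The term [c x_i] ranges between [c a] and [c (a + d)]; which of them is the smaller depends on
   the sign of [c]. *)
pose lo := p.1 0 j + Num.min (c * a) (c * (a + d)).
pose hi := p.2 0 j + Num.max (c * a) (c * (a + d)).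
apply: (@le_trans _ _ (\lam (box (box_upd (box_upd p i a (a + d)) j lo hi)))).
  apply: le_outer_measure => _ [x /box_updP[xi xk] <-]; apply/box_updP; split.
    rewrite updE eqxx; have := xk j ji; move: xi.
    move=> /andP[ax xd] /andP[jx xj].
    apply/andP; split; [apply: ltr_leD => //|apply: lerD => //].
      by rewrite ge_min; apply/orP; have [c0|c0] := leP 0 c; [left|right]; nra.
    by rewrite le_max; apply/orP; have [c0|c0] := leP 0 c; [right|left]; nra.
  move=> k kj; rewrite !updE (negbTE kj); case: eqP => [->//|/eqP ki]; exact: xk.
apply: le_trans (lebesgue_outer_box _) _; rewrite lee_fin box_volume_upd.
have -> : box_face (box_upd p i a (a + d)) j = d * rest.
  rewrite /box_face (bigD1 i) 1?eq_sym//= !updE eqxx addrAC subrr add0r.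
  rewrite max_r ?ltW//; congr (_ * _); apply: eq_big => k; first exact: andbC.
  by move=> /andP[_ ki]; rewrite !updE (negbTE ki).
have -> : Num.max 0 (hi - lo) = w j + d * `|c|.
  rewrite /w max_r; last by rewrite /lo/hi /Num.max /Num.min; do !case: ifP; lra.
  rewrite max_r; last by lra.
  rewrite /lo /hi; have [c0|c0] := leP 0 c.
    by rewrite ger0_norm// min_l ?max_r//; nra.
  by rewrite ltr0_norm// min_r ?max_l//; nra.
by rewrite le_eqVlt; apply/orP; left; apply/eqP; ring.
Qed.

End boxes.

(** * Linear maps *)

Section linear.
Context {R : realType} {n : nat}.
Implicit Types (p : 'rV[R]_n * 'rV[R]_n) (A E : set 'rV[R]_n) (x : 'rV[R]_n).

Definition scale_coord (j : 'I_n) (c : R) x := upd x j (c * x 0 j).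

Lemma lebesgue_outer_scale_box (c : R) (j : 'I_n) p :
  (\lam (scale_coord j c @` box p) <= (`|c| * box_volume p)%:E)%E.
Proof.
have [pj|pj] := leP (p.2 0 j) (p.1 0 j).
  rewrite (_ : box p = set0); last first.
    rewrite -subset0 => x /(_ j)/andP[px xp].
    by have := lt_le_trans px xp; rewrite ltNge pj.
  by rewrite image_set0 outer_measure0 lee_fin mulr_ge0// box_volume_ge0.
set a := p.1 0 j in pj *; set b := p.2 0 j in pj *.
pose P : {poly R} := (`|c| *: (b - a)%:P + 'X) * (box_face p j)%:P.
have PE d : P.[d] = (`|c| * (b - a) + d) * box_face p j by rewrite /P !hornerE.
suff : (\lam (scale_coord j c @` box p) <= P.[0]%:E)%E.
  rewrite PE addr0 -mulrA; congr (_ <= (_ * _)%:E)%E.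
  by rewrite (box_volumeE p j) max_r// subr_ge0 ltW.
apply: lee_poly_limit => d d0; rewrite PE.
(* For [c < 0] the image of a half-open interval is closed on the left, and for [c = 0] it is a
   point; lowering the left end by [d] makes it fit in a half-open interval. *)
pose lo := Num.min (c * a) (c * b) - d; pose hi := Num.max (c * a) (c * b).
apply: (@le_trans _ _ (\lam (box (box_upd p j lo hi)))).
  apply: le_outer_measure => _ [x px <-]; apply/box_updP; split.
    rewrite updE eqxx; have /andP[ax xb] := px j; rewrite -/a -/b in ax xb.
    apply/andP; rewrite /lo /hi; have [c0|c0] := leP 0 c.
      rewrite min_l ?max_r; nra.
    rewrite min_r ?max_l; nra.
  by move=> k kj; rewrite updE (negbTE kj); exact: px.
apply: le_trans (lebesgue_outer_box _) _; rewrite lee_fin box_volume_upd.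
apply: ler_wpM2r; first exact: box_face_ge0.
rewrite ge_max; apply/andP; split.
  by apply: addr_ge0 (ltW d0); rewrite mulr_ge0// subr_ge0 ltW.
rewrite /lo /hi; have [c0|c0] := leP 0 c.
  by rewrite ger0_norm// min_l ?max_r; nra.
by rewrite ltr0_norm// min_r ?max_l; nra.
Qed.

(** Only an upper bound, for arbitrary sets, hence stable under composition; for an invertible
    linear map the lower bound comes from the inverse. *)
Definition scales (F : 'rV[R]_n -> 'rV[R]_n) (c : R) :=
  forall A, (\lam (F @` A) <= c%:E * \lam A)%E.

Lemma scales_box F c : 0 < c ->
  (forall p, \lam (F @` box p) <= (c * box_volume p)%:E)%E -> scales F c.
Proof.
move=> c0 Fc A; rewrite -[X in F @` X]setIT; apply: lebesgue_outer_image_le => // p.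
by rewrite setIT.
Qed.

Lemma scales_comp F G c d : 0 <= c ->
  scales F c -> scales G d -> scales (F \o G) (c * d).
Proof.
move=> c0 Fc Gd A; rewrite -image_comp; apply: le_trans (Fc _) _.
by rewrite EFinM -muleA; apply: lee_wpmul2l; rewrite ?lee_fin.
Qed.

Lemma eq_scales F G c : F =1 G -> scales F c -> scales G c.
Proof. by move=> /funext <-. Qed.

Lemma scales_id : scales id 1.
Proof. by move=> A; rewrite image_id mul1e. Qed.

Lemma scales_addc c (j i : 'I_n) : j != i -> scales (addc c j i) 1.
Proof.
by move=> ji; apply: scales_box => // p; rewrite mul1r; exact: lebesgue_outer_addc_box.
Qed.

Definition set_coord (j : 'I_n) (c : 'I_n -> R) x := upd x j (\sum_k c k * x 0 k).

(** The map first scales coordinate [j] by [c j], then adds the multiples of the other coordinates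
    by shears, which have factor 1. *)
Lemma scales_set_coord j c : c j != 0 -> scales (set_coord j c) `|c j|.
Proof.
move=> cj.
(* Adding only the terms indexed by [s] allows an induction that performs one shear at a time. *)
pose H s x := upd x j (x 0 j + \sum_(k <- s | k != j) c k * x 0 k).
have Hs s : scales (H s) 1.
  elim: s => [|i s IH].
    apply: eq_scales scales_id => x; rewrite /H big_nil addr0 upd_id//.
  have [ij|ij] := eqVneq i j.
    by apply: eq_scales IH => x; rewrite /H big_cons ij eqxx.
  have ji : j != i by rewrite eq_sym.
  rewrite -[1]mulr1; apply: eq_scales (scales_comp ler01 (scales_addc (c i) ji) IH).
  move=> x; apply/rowP => k; rewrite /addc/= !updE/= big_cons ij eqxx.
  by case: (eqVneq k j) => // _; rewrite (negbTE ij) addrAC addrA.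
rewrite -[`|c j|]mul1r.
have Sj : scales (scale_coord j (c j)) `|c j|.
  apply: scales_box; first by rewrite normr_gt0.
  exact: lebesgue_outer_scale_box.
apply: eq_scales (scales_comp ler01 (Hs (index_enum _)) Sj) => x.
apply/rowP => k; rewrite /H/set_coord/= !updE; case: eqP => // _.
rewrite eqxx [RHS](bigD1 j)//=; congr (_ + _).
by apply: eq_bigr => i ij; rewrite updE (negbTE ij).
Qed.

(* The coordinates of x are overwritten one at a time, starting from the end of
   s; the hypothesis says that those already overwritten are no longer needed. *)
Lemma scales_triangular (M : 'M[R]_n) (s : seq 'I_n) : uniq s ->
  (forall i, M i i != 0) -> pairwise (fun j i => M i j == 0) s ->
  scales (fun x => \row_j (if j \in s then (x *m M) 0 j else x 0 j))
    (\prod_(j <- s) `|M j j|).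
Proof.
move=> + M0; elim: s => [_ _|j s IH].
  rewrite big_nil; apply: eq_scales scales_id => x.
  by apply/rowP => j; rewrite mxE.
rewrite /= => /andP[js us] /andP[Mj Ms]; rewrite big_cons.
have Sj : scales (set_coord j (fun i => M i j)) `|M j j| by exact: scales_set_coord.
apply: eq_scales (scales_comp (normr_ge0 _) Sj (IH us Ms)) => x.
apply/rowP => k; rewrite /set_coord/= updE [RHS]mxE in_cons.
case: eqP => [->|_] /=; last by rewrite mxE.
rewrite mxE; apply: eq_bigr => i _; rewrite mxE mulrC.
by case: ifP => // /(allP Mj)/eqP ->; rewrite !mulr0.
Qed.

Lemma scales_perm (s : 'S_n) : scales (mulmx^~ (perm_mx s)) 1.
Proof.
apply: scales_box => // p; rewrite mul1r.
apply: (@le_trans _ _ (\lam (box (p.1 *m perm_mx s, p.2 *m perm_mx s)))).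
  apply: le_outer_measure => _ [x px <-] i /=.
  rewrite -(invgK s)%g -!col_permE !mxE; exact: px.
apply: le_trans (lebesgue_outer_box _) _; rewrite lee_fin /box_volume.
rewrite (reindex_inj (@perm_inj _ s)) /=.
rewrite le_eqVlt; apply/orP; left; apply/eqP; apply: eq_bigr => i _.
by rewrite -(invgK s)%g -!col_permE !mxE permKV.
Qed.

End linear.

(** By the LUP decomposition, [x *m M] permutes the coordinates, then applies a unit lower
    triangular matrix, then an upper triangular one carrying the whole determinant up to sign. The
    decomposition is stated for positive dimension, whence the separate case [n = 0]. *)
Lemma scales_mulmx (R : realType) n (M : 'M[R]_n) : M \in unitmx ->
  scales (mulmx^~ M) `|\det M|.
Proof.
case: n M => [|n] M Mu.
  rewrite (_ : mulmx^~ M = id); last by apply/funext => x; apply/rowP => -[].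
  by rewrite det_mx00 normr1; exact: scales_id.
have := cormen_lup_perm M; have := cormen_lup_correct M.
have := cormen_lup_detL M; have := @cormen_lup_lower _ _ M.
have := @cormen_lup_upper _ _ M.
case: cormen_lup => [[P L] U]/= Uup Llo detL PM /is_perm_mxP[s Ps].
have Ut : is_trig_mx U^T.
  by apply/is_trig_mxP => i j ij; rewrite mxE Uup.
have Lt : is_trig_mx L.
  apply/is_trig_mxP => i j ij; rewrite Llo; last exact: ltnW.
  by rewrite -val_eqE/= ltn_eqF.
have detU : \det U = \prod_i U i i.
  by rewrite -det_tr det_trig//; apply: eq_bigr => i _; rewrite mxE.
have MLU : M = perm_mx s^-1%g *m L *m U.
  by rewrite -mulmxA [L *m U](esym PM) Ps mulmxA -perm_mxM mulVg perm_mx1 mul1mx.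
have detM : `|\det M| = `|\det U|.
  by rewrite MLU !det_mulmx detL mulr1 det_perm normrM normrX normrN1 expr1n mul1r.
have U0 i : U i i != 0.
  have : \det U != 0 by rewrite -normr_gt0 -detM normr_gt0 -unitfE -unitmxE.
  by rewrite detU => /prodf_neq0; exact.
(* Coordinate [j] of [x *m U] involves only the coordinates up to [j], so the overwriting runs from
   the last coordinate to the first. *)
have sU : scales (mulmx^~ U) `|\det U|.
  rewrite detU normr_prod -big_enum/=.
  apply: eq_scales (scales_triangular (enum_uniq _) U0 _).
    by move=> x; apply/rowP => j; rewrite mxE mem_enum.
  have: pairwise ltn (map val (enum 'I_n.+1)).
    by rewrite val_enum_ord -(sorted_pairwise ltn_trans) iota_ltn_sorted.
  by rewrite pairwise_map; apply: sub_pairwise => i j /= ij; rewrite Uup.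
(* For [L] the dependence is reversed, so the enumeration is reversed too. *)
have sL : scales (mulmx^~ L) 1.
  have L1 i : L i i = 1 by rewrite Llo// eqxx.
  rewrite (_ : 1 = \prod_(i <- rev (enum 'I_n.+1)) `|L i i|); last first.
    by rewrite big1// => i _; rewrite L1 normr1.
  apply: eq_scales (scales_triangular _ _ _).
  - by move=> x; apply/rowP => j; rewrite mxE mem_rev mem_enum.
  - by rewrite rev_uniq enum_uniq.
  - by move=> i; rewrite L1 oner_eq0.
  have: pairwise gtn (map val (rev (enum 'I_n.+1))).
    rewrite map_rev val_enum_ord -sorted_pairwise ?rev_sorted ?iota_ltn_sorted//.
    by move=> i j k /= ji ik; exact: ltn_trans ik ji.
  by rewrite pairwise_map; apply: sub_pairwise => i j /= ji; rewrite Llo ?(ltnW ji)// -val_eqE/= ltn_eqF.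
rewrite detM -[`|_|]mulr1 -[X in _ * X]mulr1; apply: eq_scales (scales_comp (normr_ge0 _) sU (scales_comp ler01 sL (scales_perm s^-1%g))).
by move=> x /=; rewrite MLU !mulmxA.
Qed.

(** * Lipschitz maps *)

Section lipschitz_images.
Context {R : realType} {n : nat}.
Implicit Types (p : 'rV[R]_n * 'rV[R]_n) (A E : set 'rV[R]_n) (x : 'rV[R]_n).

Lemma rV_norm_le x (e : R) : 0 <= e -> (`|x| <= e) <-> (forall i, `|x 0 i| <= e).
Proof.
move=> e0; rewrite /Num.Def.normr/= mx_normrE; split=> [xe i|xe].
  by apply: le_trans xe; exact: (le_bigmax _ _ (0, i)).
by apply/bigmax_leP; split => // -[i j] _ /=; rewrite ord1; exact: xe.
Qed.

Lemma rV_coord_le_norm x i : `|x 0 i| <= `|x|.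
Proof. by apply: (rV_norm_le x (normr_ge0 x)).1. Qed.

(** Slicing in one coordinate after another reduces a box to cubes of side [d]. In the induction,
    [s] lists the coordinates whose sides are still arbitrary; all the other sides have length
    [d]. *)
Lemma box_slicing_cubes (F : 'rV[R]_n -> 'rV[R]_n) E (d c : R) :
  0 < d -> 0 <= c ->
  (forall p, (forall i, p.2 0 i = p.1 0 i + d) ->
    (\lam (F @` (box p `&` E)) <= (c * d ^+ n)%:E)%E) ->
  forall p, (\lam (F @` (box p `&` E)) <=
    (c * \prod_(i < n) (Num.max 0 (p.2 0 i - p.1 0 i) + d))%:E)%E.
Proof.
move=> d0 c0 Fd p.
pose V (s : seq 'I_n) p i := if i \in s then Num.max 0 (p.2 0 i - p.1 0 i) + d else d.
have V0 s q i : 0 <= V s q i.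
  by rewrite /V; case: ifP => _; rewrite ?addr_ge0 ?le_max ?lexx ?(ltW d0).
suff H s : uniq s -> forall p, (forall i, i \notin s -> p.2 0 i = p.1 0 i + d) ->
    (\lam (F @` (box p `&` E)) <= (c * \prod_(i < n) V s p i)%:E)%E.
  have := H _ (enum_uniq 'I_n) p; under eq_bigr do rewrite /V mem_enum.
  by apply => i; rewrite mem_enum.
elim: s => [_|i s IH /andP[si us]] {}p pd.
  by rewrite /V/= prodr_const card_ord; apply: Fd => i; exact: pd.
pose P := \prod_(k < n | k != i) V (i :: s) p k.
have -> : \prod_(k < n) V (i :: s) p k = (Num.max 0 (p.2 0 i - p.1 0 i) + d) * P.
  by rewrite (bigD1 i)//= {1}/V mem_head.
rewrite (mulrC _ P) mulrA -[X in box X](box_upd_id p i).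
apply: box_slicing => //; first by apply: mulr_ge0 => //; apply: prodr_ge0.
move=> a; apply: le_trans (IH us _ _) _.
  move=> k ks; rewrite /= !updE; case: eqVneq => // ki.
  by apply: pd; rewrite inE negb_or ki.
rewrite lee_fin (bigD1 i)//= {1}/V (negbTE si) (mulrC d) mulrA.
rewrite (_ : \prod_(_ < _ | _) _ = P)//; apply: eq_bigr => k ki.
by rewrite /V/= !updE (negbTE ki) inE (negbTE ki).
Qed.

(* The image lies in a closed cube of side K d; the larger side (K + d) d makes
   room for a half-open one. *)
Lemma lipschitz_cube (F : 'rV[R]_n -> 'rV[R]_n) E (K d : R) p : 0 < K -> 0 < d ->
  {in E &, forall x y, `|F x - F y| <= K * `|x - y|} ->
  (forall i, p.2 0 i = p.1 0 i + d) ->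
  (\lam (F @` (box p `&` E)) <= ((K + d) ^+ n * d ^+ n)%:E)%E.
Proof.
move=> K0 d0 FK pd.
have [->|/set0P[x0 [px0 Ex0]]] := eqVneq (box p `&` E) set0.
  by rewrite image_set0 outer_measure0 lee_fin mulr_ge0// exprn_ge0// ?addr_ge0 ?ltW.
have Fd x y i : (box p `&` E) x -> (box p `&` E) y -> F x 0 i - F y 0 i <= K * d.
  move=> [px Ex] [py Ey]; rewrite (_ : _ - _ = (F x - F y) 0 i); last by rewrite !mxE.
  apply: le_trans (ler_norm _) _; apply: le_trans (rV_coord_le_norm _ _) _.
  apply: le_trans (FK _ _ _ _) _; rewrite ?inE//.
  apply: ler_wpM2l; first exact: ltW.
  apply/rV_norm_le; first exact: ltW.
  move=> k; rewrite !mxE ler_norml.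
  have := px k; have := py k; rewrite pd => /andP[? ?] /andP[? ?]; lra.
pose S i := [set F x 0 i | x in box p `&` E].
have S0 i : S i !=set0 by exists (F x0 0 i), x0.
have Sub x i : (box p `&` E) x -> F x 0 i <= sup (S i).
  move=> px; apply: ub_le_sup; last by exists x.
  exists (F x0 0 i + K * d) => _ [y py <-].
  by rewrite -lerBlDl; exact: Fd.
have Slb x i : (box p `&` E) x -> sup (S i) <= F x 0 i + K * d.
  move=> px; apply: ge_sup => // _ [y py <-].
  by rewrite -lerBlDl; exact: Fd.
pose q : 'rV[R]_n * 'rV[R]_n :=
  (\row_i (sup (S i) - (K + d) * d), \row_i sup (S i)).
apply: (@le_trans _ _ (\lam (box q))).
  apply: le_outer_measure => _ [x px <-] i /=; rewrite !mxE Sub// andbT.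
  rewrite ltrBlDr; apply: le_lt_trans (Slb x i px) _.
  by rewrite ltrD2l mulrDl ltrDl mulr_gt0.
apply: le_trans (lebesgue_outer_box _) _; rewrite lee_fin /box_volume.
under eq_bigr => i _.
  rewrite !mxE opprB addrC subrK max_r; last by rewrite mulr_ge0// ?addr_ge0// ltW.
  over.
by rewrite prodr_const card_ord exprMn.
Qed.

(** Cutting boxes into cubes of side [d] gives a bound polynomial in [d], whose value at 0 is
    [K ^+ n] times the volume. *)
Lemma lebesgue_outer_lipschitz (F : 'rV[R]_n -> 'rV[R]_n) E (K : R) : 0 < K ->
  {in E &, forall x y, `|F x - F y| <= K * `|x - y|} ->
  forall A, (\lam (F @` (A `&` E)) <= (K ^+ n)%:E * \lam A)%E.
Proof.
move=> K0 FK; apply: lebesgue_outer_image_le; first exact: exprn_gt0.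
move=> p; pose w i := Num.max 0 (p.2 0 i - p.1 0 i).
pose P : {poly R} := (K%:P + 'X) ^+ n * \prod_(i < n) ((w i)%:P + 'X).
have PE d : P.[d] = (K + d) ^+ n * \prod_(i < n) (w i + d).
  rewrite /P hornerM horner_exp !hornerE horner_prod.
  by congr (_ * _); apply: eq_bigr => i _; rewrite !hornerE.
rewrite (_ : _ * _ = P.[0]); last first.
  by rewrite PE addr0; congr (_ * _); apply: eq_bigr => i _; rewrite addr0.
apply: lee_poly_limit => d d0; rewrite PE.
apply: box_slicing_cubes => //; first by rewrite exprn_ge0// addr_ge0 ?ltW.
by move=> q qd; exact: lipschitz_cube.
Qed.

End lipschitz_images.

(** * Borel and Lebesgue sets *)

Section sigma_algebras.
Context {T : Type} (S : set (set T)) (sS : sigma_algebra setT S).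

Lemma sigma_algebra_setC A : S A -> S (~` A).
Proof. by case: sS => _ + _ => /[apply]; rewrite setTD. Qed.

Lemma sigma_algebra_bigcup (I : choiceType) (D : set I) (A : I -> set T) :
  countable D -> (forall i, D i -> S (A i)) -> S (\bigcup_(i in D) A i).
Proof.
move=> /countable_injP[f finj] SA; have [S0 _ SU] := sS.
rewrite (_ : \bigcup_(i in D) A i =
    \bigcup_k \bigcup_(i in D `&` [set i | f i = k]) A i).
  apply: SU => k; have [[i [Di fi]]|nk] := pselect (exists i, D i /\ f i = k).
    rewrite (_ : \bigcup_(_ in _) _ = A i); first exact: SA.
    apply/seteqP; split => [x [j [Dj fj]]|x Ax]; last by exists i.
    by rewrite (finj j i) ?inE// fi.
  rewrite (_ : \bigcup_(_ in _) _ = set0)// -subset0 => x [i [Di fi] _].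
  by apply: nk; exists i.
apply/seteqP; split => [x [i Di Ax]|x [k _ [i [Di _] Ax]]]; last by exists i.
by exists (f i) => //; exists i.
Qed.

Lemma sigma_algebra_bigcap (I : choiceType) (D : set I) (A : I -> set T) :
  countable D -> (forall i, D i -> S (A i)) -> S (\bigcap_(i in D) A i).
Proof.
move=> cD SA; rewrite -[X in S X]setCK setC_bigcap; apply: sigma_algebra_setC.
by apply: sigma_algebra_bigcup => // i /SA/sigma_algebra_setC.
Qed.

Lemma sigma_algebra_setU A B : S A -> S B -> S (A `|` B).
Proof.
move=> SA SB.
rewrite (_ : A `|` B = \bigcup_(b in [set: bool]) (if b then A else B)).
  by apply: sigma_algebra_bigcup => [|[]//]; exact: countableP.
by apply/seteqP; split => [x [Ax|Bx]|x [[] _ ?]]; [exists true|exists false|left|right].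
Qed.

Lemma sigma_algebra_setI A B : S A -> S B -> S (A `&` B).
Proof.
move=> SA SB; rewrite -[A `&` B]setCK setCI; apply: sigma_algebra_setC.
by apply: sigma_algebra_setU; exact: sigma_algebra_setC.
Qed.

End sigma_algebras.

Section lebesgue_sets.
Context {R : realType} {n : nat}.
Implicit Types (p : 'rV[R]_n * 'rV[R]_n) (A B E N U : set 'rV[R]_n) (x : 'rV[R]_n).

(** The measurable sets of [Rn R n], viewed on plain row vectors, where the topology and the Borel
    sets live. *)
Definition lebesgue_measurable A := (@lebesgue_outer R n).-caratheodory A.

Definition borel : set (set 'rV[R]_n) := <<s open >>.

Lemma sigma_algebra_lebesgue : sigma_algebra setT lebesgue_measurable.
Proof.
split; first exact: caratheodory_measurable_set0.
  by move=> A mA; rewrite setTD; exact: caratheodory_measurable_setC.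
exact: caratheodory_measurable_bigcup.
Qed.

Lemma sigma_algebra_borel : sigma_algebra setT borel.
Proof. exact: smallest_sigma_algebra. Qed.

(** Stated for any sigma-algebra containing the half-spaces, to serve for Lebesgue and for Borel
    sets. *)
Lemma box_sigma_algebra (S : set (set 'rV[R]_n)) p : sigma_algebra setT S ->
  (forall i t, S [set x | x 0 i <= t]) -> S (box p).
Proof.
move=> sS Sh; rewrite (_ : box p = \bigcap_(i in [set: 'I_n])
    ([set x | x 0 i <= p.2 0 i] `&` ~` [set x | x 0 i <= p.1 0 i])).
  apply: sigma_algebra_bigcap => // [|i _]; first exact: countableP.
  by apply: sigma_algebra_setI => //; apply: sigma_algebra_setC.
apply/seteqP; split => x xp i; have := xp i.
  by move=> /andP[px xp2] _; split => //=; apply/negP; rewrite -ltNge.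
by move=> /(_ I)[/= -> /negP]; rewrite -ltNge => ->.
Qed.

Lemma box_lebesgue p : lebesgue_measurable (box p).
Proof.
apply: box_sigma_algebra; first exact: sigma_algebra_lebesgue.
exact: halfspace_caratheodory.
Qed.

Lemma open_borel U : open U -> borel U.
Proof. by move=> oU; exact: sub_sigma_algebra. Qed.

Lemma closed_borel U : closed U -> borel U.
Proof.
move=> cU; rewrite -[U]setCK; apply: (sigma_algebra_setC sigma_algebra_borel).
by apply: open_borel; rewrite openC.
Qed.

Lemma box_borel p : borel (box p).
Proof.
apply: box_sigma_algebra; first exact: sigma_algebra_borel.
move=> i t; apply: closed_borel.
apply: (@closed_comp _ _ (fun x : 'rV[R]_n => x 0 i) [set y | y <= t]).
  by move=> x _; exact: coord_continuous.
exact: closed_le.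
Qed.

Definition closed_box p : set 'rV[R]_n :=
  [set x | forall i, p.1 0 i <= x 0 i <= p.2 0 i].

Lemma sub_box_closed_box p : box p `<=` closed_box p.
Proof. by move=> x px i; have /andP[/ltW -> ->] := px i. Qed.

Lemma compact_closed_box p : compact (closed_box p).
Proof.
rewrite (_ : closed_box p =
    [set x : 'rV[R]_n | forall i, `[p.1 0 i, p.2 0 i]%classic (x 0 i)]).
  apply: (@rV_compact _ _ (fun i => `[p.1 0 i, p.2 0 i]%classic)) => i.
  exact: segment_compact.
by apply/seteqP; split => x px i; have := px i; rewrite /= in_itv.
Qed.

Definition rat_box (q : 'rV[rat]_n * 'rV[rat]_n) : 'rV[R]_n * 'rV[R]_n :=
  (map_mx ratr q.1, map_mx ratr q.2).

(** Rational boxes give the countable covers used throughout: the half-open box contains the point,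
    and the closed one, which is compact, stays inside the neighbourhood. *)
Lemma nbhs_rat_box x U : nbhs x U ->
  exists q, box (rat_box q) x /\ closed_box (rat_box q) `<=` U.
Proof.
move=> /nbhs_ballP[e /= e0 eU].
have /choice[a aP] i : exists q : rat, x 0 i - e / 2 < ratr q < x 0 i.
  have /rat_in_itvoo[q] : x 0 i - e / 2 < x 0 i by rewrite ltrBlDr ltrDl divr_gt0.
  by rewrite in_itv/=; exists q.
have /choice[b bP] i : exists q : rat, x 0 i < ratr q < x 0 i + e / 2.
  have /rat_in_itvoo[q] : x 0 i < x 0 i + e / 2 by rewrite ltrDl divr_gt0.
  by rewrite in_itv/=; exists q.
exists (\row_i a i, \row_i b i); split => [i|y yab].
  by rewrite /rat_box/= !mxE; have := aP i; have := bP i; lra.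
apply: eU; rewrite mx_norm_ball /ball_/=.
apply: (@le_lt_trans _ _ (e / 2)); last by rewrite ltr_pdivrMr// ltr_pMr// ltr1n.
apply/rV_norm_le; first by rewrite divr_ge0 ?ltW.
move=> i; have := yab i; have := aP i; have := bP i; rewrite /rat_box/= !mxE.
by rewrite ler_norml; lra.
Qed.

Lemma open_rat_boxes U : open U ->
  U = \bigcup_(q in [set q | closed_box (rat_box q) `<=` U]) box (rat_box q).
Proof.
move=> oU; apply/seteqP; split => [x Ux|x [q /= qU] /sub_box_closed_box/qU//].
by have [q [qx qU]] := nbhs_rat_box (open_nbhs_nbhs (conj oU Ux)); exists q.
Qed.

Lemma open_closed_rat_boxes U : open U ->
  U = \bigcup_(q in [set q | closed_box (rat_box q) `<=` U]) closed_box (rat_box q).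
Proof.
move=> oU; apply/seteqP; split => [|x [q /= qU] /qU//].
rewrite {1}(open_rat_boxes oU) => x [q qU /sub_box_closed_box qx].
by exists q.
Qed.

Lemma sub_borel_lebesgue : borel `<=` lebesgue_measurable.
Proof.
apply: smallest_sub; first exact: sigma_algebra_lebesgue.
move=> U oU; rewrite (open_rat_boxes oU).
apply: (sigma_algebra_bigcup sigma_algebra_lebesgue) => [|q _].
  exact: countableP.
exact: box_lebesgue.
Qed.

Lemma borel_preimage (T : 'rV[R]_n -> 'rV[R]_n) : continuous T ->
  forall B, borel B -> borel (T @^-1` B).
Proof.
move=> cT; apply: smallest_sub; last first.
  by move=> U oU; apply: open_borel; apply: open_comp oU => x _; exact: cT.
have [b0 bC bU] := sigma_algebra_borel; split.
- by rewrite /= preimage_set0.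
- by move=> B bB /=; rewrite setTD preimage_setC -setTD; exact: bC.
- by move=> B bB /=; rewrite preimage_bigcup; exact: bU.
Qed.

(* Images of open sets are countable unions of compact sets, and injectivity
   makes the sets with measurable image a sigma-algebra. *)
Lemma borel_image (T : 'rV[R]_n -> 'rV[R]_n) : continuous T -> injective T ->
  forall B, borel B -> lebesgue_measurable (T @` B).
Proof.
move=> cT injT.
have openU U : open U -> lebesgue_measurable (T @` U).
  move=> /open_closed_rat_boxes ->; rewrite image_bigcup.
  apply: (sigma_algebra_bigcup sigma_algebra_lebesgue) => [|q _].
    exact: countableP.
  apply: sub_borel_lebesgue; apply: closed_borel.
  apply: compact_closed; first exact: norm_hausdorff.
  apply: continuous_compact; last exact: compact_closed_box.
  exact: continuous_subspaceT.
apply: smallest_sub => //; split.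
- by rewrite /= image_set0; exact: caratheodory_measurable_set0.
- move=> B mB /=; rewrite (_ : T @` _ = T @` setT `&` ~` (T @` B)).
    apply: caratheodory_measurable_setI; first by apply: openU; exact: openT.
    exact: caratheodory_measurable_setC.
  apply/seteqP; split=> [_ [x [_ Bx] <-]|_ [[x _ <-] nTB]].
    by split; [exists x|move=> [y By /injT yx]; apply: Bx; rewrite -yx].
  by exists x => //; split => // Bx; apply: nTB; exists x.
- move=> B mB /=; rewrite image_bigcup.
  exact: caratheodory_measurable_bigcup.
Qed.

Lemma lebesgue_null N : \lam N = 0 -> lebesgue_measurable N.
Proof.
move=> N0; apply: le_caratheodory_measurable => X.
rewrite (_ : _ (X `&` N) = 0%E) ?add0e.
  by apply: le_outer_measure => x [].
apply/eqP; rewrite eq_le outer_measure_ge0 andbT -N0.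
by apply: le_outer_measure => x [].
Qed.

Lemma subset_lebesgue_null N E : E `<=` N -> \lam N = 0 -> \lam E = 0.
Proof.
move=> EN N0; apply/eqP; rewrite eq_le outer_measure_ge0 andbT -N0.
exact: le_outer_measure.
Qed.

Lemma bigcup_lebesgue_null (I : countType) (D : set I) (N : I -> set 'rV[R]_n) :
  (forall i, D i -> \lam (N i) = 0) -> \lam (\bigcup_(i in D) N i) = 0.
Proof.
move=> N0; apply/eqP; rewrite eq_le outer_measure_ge0 andbT.
apply: (@le_trans _ _ (\esum_(i in D) \lam (N i))%E).
  by apply: outer_measure_countable_bigcup; exact: countableP.
by rewrite esum1.
Qed.

End lebesgue_sets.

(** * Approximation of Lebesgue sets by Borel sets *)

Section regularity.
Context {R : realType} {n : nat}.
Implicit Types (p : 'rV[R]_n * 'rV[R]_n) (A B E N U : set 'rV[R]_n) (x : 'rV[R]_n).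

(** Intersect the unions of covers of [A] whose total volumes exceed its outer measure by at most
    [1 / (m + 1)]. *)
Lemma lebesgue_outer_hull A : (\lam A < +oo)%E ->
  exists G, [/\ borel G, A `<=` G & (\lam G <= \lam A)%E].
Proof.
move=> Afin.
have Anum : \lam A \is a fin_num by rewrite ge0_fin_numE// outer_measure_ge0.
have /choice[D DP] (m : nat) : exists D, box_cover A D /\
    (\esum_(p in D) (box_volume p)%:E <= \lam A + (m.+1%:R^-1)%:E)%E.
  have m0 : 0 < m.+1%:R^-1 :> R by rewrite invr_gt0.
  have [_ [D cD <-] Dlt] := lb_ereal_inf_adherent m0 Anum.
  by exists D; split => //; exact: ltW.
exists (\bigcap_m \bigcup_(p in D m) box p); split.
- apply: (sigma_algebra_bigcap sigma_algebra_borel) => [|m _].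
    exact: countableP.
  apply: (sigma_algebra_bigcup sigma_algebra_borel) => [|p _]; last exact: box_borel.
  by case: (DP m) => -[].
- by move=> x Ax m _; case: (DP m) => -[_ /(_ _ Ax)].
apply/lee_addgt0Pr => e e0.
have [m me] : exists m, m.+1%:R^-1 < e.
  exists (Num.truncn e^-1); rewrite invf_plt ?posrE//.
  by have /andP[_] := truncn_itv (ltW (divr_gt0 ltr01 e0)); rewrite div1r.
apply: (@le_trans _ _ (\lam (\bigcup_(p in D m) box p))).
  by apply: le_outer_measure => x; apply.
have [[cD _] Dm] := DP m.
apply: (@le_trans _ _ (\esum_(p in D m) \lam (box p))%E).
  exact: outer_measure_countable_bigcup.
apply: (@le_trans _ _ (\esum_(p in D m) (box_volume p)%:E)%E).
  by apply: le_esum => p _; exact: lebesgue_outer_box.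
apply: le_trans Dm _; apply: leeD2l.
by rewrite lee_fin ltW.
Qed.

Lemma lebesgue_inner_borel A : lebesgue_measurable A ->
  exists B, [/\ borel B, B `<=` A & \lam (A `\` B) = 0].
Proof.
(* The bounded parts of the complement have finite measure, which can be cancelled, so that each
   differs from its Borel hull by a null set. The complement of the union of these hulls is the
   required set. *)
move=> mA; pose C (m : nat) := ~` A `&` box (const_mx (- m%:R), const_mx m%:R).
have mC m : lebesgue_measurable (C m).
  apply: caratheodory_measurable_setI; last exact: box_lebesgue.
  exact: caratheodory_measurable_setC.
have Cfin m : (\lam (C m) < +oo)%E.
  apply: (@le_lt_trans _ _ (\lam (box (const_mx (- m%:R), const_mx m%:R)))).
    by apply: le_outer_measure; exact: subIsetr.
  by apply: le_lt_trans (lebesgue_outer_box _) _; rewrite ltry.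
have /choice[G GP] m := lebesgue_outer_hull (Cfin m).
have GC0 m : \lam (G m `\` C m) = 0.
  have [_ CG] := GP m; rewrite (mC m (G m)).
  have -> : G m `&` C m = C m by apply/setIidPr.
  have Cnum : \lam (C m) \is a fin_num by rewrite ge0_fin_numE ?outer_measure_ge0.
  rewrite -[leRHS]adde0 leeD2lE// => GC.
  by apply/eqP; rewrite eq_le outer_measure_ge0 andbT.
exists (~` \bigcup_m G m); split.
- apply: (sigma_algebra_setC sigma_algebra_borel).
  apply: (sigma_algebra_bigcup sigma_algebra_borel) => [|m _]; first exact: countableP.
  by case: (GP m).
- move=> x Gx; apply: contrapT => Ax; apply: Gx.
  pose m := (Num.truncn `|x|).+1.
  have xm : `|x| < m%:R.
    by have /andP[] := truncn_itv (normr_ge0 x).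
  exists m => //; case: (GP m) => _ + _; apply; split => // i /=; rewrite !mxE.
  have := rV_coord_le_norm x i; rewrite ler_norml => /andP[? ?].
  by apply/andP; split; lra.
apply: (@subset_lebesgue_null _ _ (\bigcup_m (G m `\` C m))).
  move=> x [Ax /contrapT[m _ Gx]]; exists m => //; split => // -[]//.
by apply: bigcup_lebesgue_null.
Qed.

End regularity.

(** * Images of null and measurable sets under locally Lipschitz maps *)

Section locally_lipschitz_images.
Context {R : realType} {n : nat} (T : 'rV[R]_n -> 'rV[R]_n).
Hypothesis lipT : locally_lipschitz T.
Implicit Types (p : 'rV[R]_n * 'rV[R]_n) (A B E N U : set 'rV[R]_n) (x : 'rV[R]_n).

Let lipschitz_nbhs x : exists U, exists2 K, nbhs x U /\ 0 < K &
  {in U &, forall y z, `|T y - T z| <= K * `|y - z|}.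
Proof.
have [U xU /pinfty_ex_gt0[K K0 TK]] := lipT x.
exists U; exists K => // y z; rewrite !inE => Uy Uz.
exact: (TK (y, z)).
Qed.

Lemma locally_lipschitz_continuous : continuous T.
Proof.
move=> x; have [U [K [xU K0] TK]] := lipschitz_nbhs x.
apply/(@cvgrPdist_lt _ _ _ (nbhs x)) => e e0; near=> y.
have Uy : U y by near: y.
have xy : `|x - y| < e / K by near: y; apply: cvgr_dist_lt; rewrite ?divr_gt0.
apply: le_lt_trans (TK _ _ _ _) _; rewrite ?inE//; first exact: nbhs_singleton.
by rewrite mulrC -ltr_pdivlMr.
Unshelve. all: by end_near. Qed.

(** Countably many rational boxes on which [T] is Lipschitz cover the space, and a Lipschitz map
    sends null sets to null sets. *)
Lemma locally_lipschitz_null N : \lam N = 0 -> \lam (T @` N) = 0.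
Proof.
move=> N0.
pose D := [set q | exists2 K, 0 < K &
  {in box (@rat_box R n q) &, forall y z, `|T y - T z| <= K * `|y - z|}].
rewrite (_ : T @` N = \bigcup_(q in D) (T @` (N `&` box (rat_box q)))).
  apply: bigcup_lebesgue_null => q [K K0 TK].
  apply/eqP; rewrite eq_le outer_measure_ge0 andbT.
  by have := lebesgue_outer_lipschitz K0 TK N; rewrite N0 mule0.
apply/seteqP; split => [_ [x Nx <-]|_ [q _ [x [Nx _] <-]]]; last by exists x.
have [U [K [xU K0] TK]] := lipschitz_nbhs x.
have [q [qx qU]] := nbhs_rat_box xU.
exists q; last by exists x.
exists K => // y z; rewrite !inE => yq zq.
by apply: TK; rewrite inE; apply: qU; exact: sub_box_closed_box.
Qed.

(** A measurable set is a Borel set together with a null set. Injectivity takes care of the image of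
    the first, the Lipschitz property of the second. *)
Lemma lebesgue_image A : injective T ->
  lebesgue_measurable A -> lebesgue_measurable (T @` A).
Proof.
move=> injT mA; have [B [bB BA AB0]] := lebesgue_inner_borel mA.
rewrite -(setUIDK A B) image_setU; apply: caratheodory_measurable_setU.
  rewrite (_ : A `&` B = B); last exact/setIidPr.
  exact: borel_image locally_lipschitz_continuous injT _ bB.
by apply: lebesgue_null; exact: locally_lipschitz_null.
Qed.

End locally_lipschitz_images.

(** * Derivatives *)

Section matrix_estimates.
Context {R : realType} {n : nat}.
Implicit Types (x v : 'rV[R]_n) (M : 'M[R]_n).

Lemma mx_coord_le_norm M i j : `|M i j| <= `|M|.
Proof. by rewrite {2}/Num.Def.normr/= mx_normrE; exact: (le_bigmax _ _ (i, j)). Qed.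

Lemma norm_mulmx_le v M : `|v *m M| <= n%:R * `|M| * `|v|.
Proof.
apply/rV_norm_le; first by rewrite !mulr_ge0.
move=> j; rewrite mxE; apply: le_trans (ler_norm_sum _ _ _) _.
apply: (@le_trans _ _ (\sum_(i < n) `|M| * `|v|)).
  apply: ler_sum => i _; rewrite normrM mulrC.
  by rewrite ler_pM ?mx_coord_le_norm ?rV_coord_le_norm.
by rewrite sumr_const card_ord -mulrA mulr_natl.
Qed.

Lemma continuous_det : continuous (@determinant R n).
Proof.
have cprod (s : 'S_n) (t : seq 'I_n) :
    continuous (fun M => \prod_(i <- t) M i (s i)).
  elim: t => [|i t IH].
    by under eq_fun do rewrite big_nil; exact: cst_continuous.
  under eq_fun do rewrite big_cons.
  by move=> M; apply: continuousM; [exact: coord_continuous|exact: IH].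
have csum (t : seq 'S_n) :
    continuous (fun M => \sum_(s <- t) (-1) ^+ s * \prod_i M i (s i)).
  elim: t => [|s t IH].
    by under eq_fun do rewrite big_nil; exact: cst_continuous.
  under eq_fun do rewrite big_cons.
  have cs : continuous (fun M : 'M[R]_n => (-1) ^+ s * \prod_i M i (s i)).
    by move=> M; exact: (continuousM (@cst_continuous _ _ ((-1) ^+ s : R) M) (cprod s _ M)).
  by move=> M; exact: (continuousD (cs M) (IH M)).
exact: csum.
Qed.

Lemma rat_mx_dense M (e : R) : 0 < e -> exists L : 'M[rat]_n, `|map_mx ratr L - M| < e.
Proof.
move=> e0.
have /choice[f fP] (ij : 'I_n * 'I_n) : exists q : rat, `|ratr q - M ij.1 ij.2| < e.
  have /rat_in_itvoo[q] : M ij.1 ij.2 < M ij.1 ij.2 + e by rewrite ltrDl.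
  by rewrite in_itv/= => q_itv; exists q; rewrite ltr_norml; lra.
exists (\matrix_(i, j) f (i, j)).
rewrite {1}/Num.Def.normr/= mx_normrE.
by apply/bigmax_ltP; split => // -[i j] _; rewrite !mxE; exact: fP (i, j).
Qed.

End matrix_estimates.

Section invertible_derivative.
Context {R : realType} {n : nat} (T : 'rV[R]_n -> 'rV[R]_n).
Implicit Types (x y : 'rV[R]_n) (r e : R).

(* No differentiability is assumed: where T is not differentiable, 'd T x is
   the default value \0 of [get], which is singular unless n = 0. *)
Lemma jacobian_approx x e : jacobian T x \in unitmx -> 0 < e ->
  \forall y \near x, `|T y - T x - (y - x) *m jacobian T x| <= e * `|y - x|.
Proof.
move=> Ju e0.
have [dT|ndT] := pselect (differentiable T x).
  have [_ /eqaddoP/(_ e e0)/nbhs_ballP[d /= d0 dP]] := (diff_locallyP _ _).1 dT.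
  apply/nbhs_ballP; exists d => //= y xy.
  have := dP (y - x); rewrite /jacobian mul_rV_lin1 !fctE/= subrK opprD addrA.
  apply; move: xy; rewrite !mx_norm_ball /ball_/= sub0r normrN distrC//.
case: (posnP n) => [n0|n0].
  have v0 (v : 'rV[R]_n) : v = 0 by apply/rowP => i; have := ltn_ord i; rewrite {2}n0.
  apply/nbhs_ballP; exists 1 => //= y _.
  by rewrite [X in `|X| <= _]v0 normr0; apply: mulr_ge0 => //; exact: ltW.
suff J0 : jacobian T x = 0.
  have det00 m : (0 < m)%N -> \det (0 : 'M[R]_m) = 0.
    by case: m => // m _; exact: det0.
  by move: Ju; rewrite J0 unitmxE det00// unitr0.
have dT0 : 'd T x = \0 :> (_ -> _).
  suff -> : 'd T x = point by [].
  by move: ndT => /diffP; rewrite /diff; case: xgetP => [df _ Pdf []|].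
by apply/matrixP => i j; rewrite mxE dT0 !mxE.
Qed.


(** With the radius [d] as a parameter, a set of such points of diameter less than [d] satisfies the
    estimate for all pairs of its points. *)
Definition expansive_at (L : 'M[R]_n) r (d : R) : set 'rV[R]_n :=
  [set x | forall y, `|y - x| < d -> r * `|(y - x) *m L| <= `|T y - T x|].

Lemma closed_expansive_at L r d : continuous T -> closed (expansive_at L r d).
Proof.
move=> cT.
have cN (f : 'rV[R]_n -> 'rV[R]_n) : continuous f -> continuous (fun x => `|f x|).
  by move=> cf x; apply: continuous_comp; [exact: cf|exact: norm_continuous].
have csub (f : 'rV[R]_n -> 'rV[R]_n) v : continuous f -> continuous (fun x => v - f x).
  move=> cf x; exact: (continuousB (@cst_continuous _ _ v x) (cf x)).
have cL : continuous (mulmx^~ L : 'rV[R]_n -> 'rV[R]_n).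
  pose C : R := n%:R * `|L| + 1.
  have C0 : 0 < C by rewrite ltr_wpDl// mulr_ge0.
  move=> x; apply/(@cvgrPdist_lt _ _ _ (nbhs x)) => e e0; near=> y.
  rewrite -mulmxBl; apply: le_lt_trans (norm_mulmx_le _ _) _.
  apply: (@le_lt_trans _ _ (C * `|x - y|)); first by rewrite ler_wpM2r// lerDl.
  by rewrite mulrC -ltr_pdivlMr//; near: y; apply: cvgr_dist_lt; rewrite ?divr_gt0.
(* For fixed [y] the implication becomes a union of two conditions on [x], each closed. *)
rewrite (_ : expansive_at L r d = \bigcap_(y in [set: 'rV[R]_n])
    ([set x | d <= `|y - x|] `|` [set x | r * `|(y - x) *m L| - `|T y - T x| <= 0])); last first.
  apply/seteqP; split => [x xd y _ /=|x xd y yd].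
    have [dy|yd] := leP d `|y - x|; [by left|right; rewrite subr_le0; exact: xd].
  case: (xd y I) => /=; first by rewrite leNgt yd.
  by rewrite subr_le0.
have cid : continuous (id : 'rV[R]_n -> 'rV[R]_n) by move=> x U.
apply: closed_bigI => y _; apply: closedU.
  apply: (@closed_comp _ _ (fun x : 'rV[R]_n => `|y - x|) [set t | d <= t]).
    by move=> x _; apply: cN; exact: (csub id).
  exact: closed_ge.
apply: (@closed_comp _ _ (fun x : 'rV[R]_n => r * `|(y - x) *m L| - `|T y - T x|)
   [set t | t <= 0]); last exact: closed_le.
move=> x _.
have c1 : continuous (fun x => `|(y - x) *m L|).
  by apply: cN => z; exact: (continuous_comp (csub id y cid z) (@cL (y - z))).
have c2 : continuous (fun x => `|T y - T x|) by apply: cN; exact: csub.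
exact: (continuousB (continuousM (@cst_continuous _ _ r x) (c1 x)) (c2 x)).
Unshelve. all: by end_near. Qed.

Lemma rat_expansive_at x r : 0 < r < 1 -> jacobian T x \in unitmx ->
  exists (L : 'M[rat]_n) (k : nat), let L' := map_mx ratr L in
    [/\ L' \in unitmx, r * `|\det (jacobian T x)| <= `|\det L'| &
        expansive_at L' r k.+1%:R^-1 x].
Proof.
move=> /andP[r0 r1] Ju; set J := jacobian T x in Ju *.
(* [C] bounds the inverse of [J]; adding 1 keeps it positive. *)
pose C : R := n%:R * `|invmx J| + 1.
have C0 : 0 < C by rewrite ltr_wpDl// mulr_ge0.
have vC (v : 'rV[R]_n) : `|v| <= C * `|v *m J|.
  rewrite -{1}[v](mulmxK Ju); apply: le_trans (norm_mulmx_le _ _) _.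
  by rewrite ler_wpM2r// lerDl.
(* The relative error allowed in the end is [mu]. Half of it goes to differentiability, through
   [eta], and half to the replacement of [J] by a rational matrix, through [d2]; moreover
   [C eta <= 1/2] serves to absorb [|v|]. *)
pose mu := r^-1 - 1.
have mu0 : 0 < mu by rewrite subr_gt0 invf_gt1.
pose eta := Num.min (2 * C)^-1 (mu / (4 * C)).
have eta0 : 0 < eta by rewrite lt_min invr_gt0 divr_gt0 ?mulr_gt0.
have etaC : C * eta <= 2^-1.
  have : eta <= (2 * C)^-1 by rewrite ge_min lexx.
  by move=> /(ler_wpM2l (ltW C0))/le_trans; apply; rewrite invfM mulrCA mulfV ?gt_eqF// mulr1.
have etamu : C * eta <= mu / 4.
  have : eta <= mu / (4 * C) by rewrite ge_min lexx orbT.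
  move=> /(ler_wpM2l (ltW C0))/le_trans; apply.
  by rewrite invfM mulrCA (mulrCA C) mulfV ?gt_eqF// mulr1.
have J0 : 0 < `|\det J| by rewrite normr_gt0 -unitfE -unitmxE.
have [d1 d10 detd] : exists2 d1, 0 < d1 & forall L : 'M[R]_n, `|L - J| < d1 ->
    r * `|\det J| < `|\det L|.
  have e0 : 0 < (1 - r) * `|\det J| by rewrite mulr_gt0// subr_gt0.
  have /cvgrPdist_lt/(_ _ e0)/nbhs_ballP[d1 /= d10 dP] := @continuous_det _ _ J.
  exists d1 => // L LJ; have := dP L; rewrite mx_norm_ball /ball_/= distrC => /(_ LJ).
  by have := lerB_dist (\det J) (\det L); lra.
pose d2 := mu / (4 * C * n.+1%:R).
have d20 : 0 < d2 by rewrite divr_gt0// !mulr_gt0.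
have nd2 : C * (n%:R * d2) <= mu / 4.
  apply: (@le_trans _ _ (C * (n.+1%:R * d2))).
    by apply: (ler_wpM2l (ltW C0)); apply: (ler_wpM2r (ltW d20)); rewrite ler_nat.
  rewrite le_eqVlt; apply/orP; left; apply/eqP; rewrite /d2; field.
  by rewrite gt_eqF//= gt_eqF// ltr_wpDl.
have [L Ld] : exists L : 'M[rat]_n, `|map_mx ratr L - J| < Num.min d1 d2.
  by apply: rat_mx_dense; rewrite lt_min d10 d20.
move: Ld; rewrite lt_min => /andP[Ld1 Ld2]; set L' := map_mx ratr L in Ld1 Ld2.
have /nbhs_ballP[e /= e0 eP] := jacobian_approx Ju eta0.
have [k ke] : exists k : nat, k.+1%:R^-1 < e.
  exists (Num.truncn e^-1); rewrite invf_plt ?posrE//.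
  by have /andP[_] := truncn_itv (ltW (divr_gt0 ltr01 e0)); rewrite div1r.
exists L, k; split.
- by rewrite unitmxE unitfE -normr_gt0; apply: lt_trans (detd _ Ld1); rewrite mulr_gt0.
- exact: ltW (detd _ Ld1).
move=> y yx.
have xy : ball x e y.
  by rewrite mx_norm_ball /ball_/= distrC; exact: lt_trans yx ke.
have {xy} := eP y xy; rewrite -/J; set v := y - x; set D := T y - T x => Dv.
have vJ : `|v *m J| <= `|D| + eta * `|v|.
  have := ler_distD D (v *m J) 0; rewrite !subr0 => /le_trans; apply.
  by rewrite addrC lerD2l distrC.
(* From [|v| <= C |v J| <= C |D| + C eta |v|], where the last term is at most [|v| / 2]. *)
have vD : `|v| <= 2 * C * `|D|.
  have := le_trans (vC v) (ler_wpM2l (ltW C0) vJ).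
  have := normr_ge0 v; have := normr_ge0 D; nra.
have vL : `|v *m L'| <= `|v *m J| + n%:R * d2 * `|v|.
  rewrite -[L'](subrK J) mulmxDr addrC; apply: le_trans (ler_normD _ _) _.
  rewrite lerD2l; apply: le_trans (norm_mulmx_le _ _) _.
  by rewrite ler_wpM2r// ler_wpM2l// ltW.
have vLD : `|v *m L'| <= r^-1 * `|D|.
  have vLv : `|v *m L'| <= `|D| + (eta + n%:R * d2) * `|v| by lra.
  have : (eta + n%:R * d2) * `|v| <= mu * `|D|.
    have h0 : 0 <= eta + n%:R * d2.
      by apply: addr_ge0; [|apply: mulr_ge0 => //]; exact: ltW.
    apply: le_trans (ler_wpM2l h0 vD) _.
    have : (C * eta + C * (n%:R * d2)) * `|D| <= (mu / 4 + mu / 4) * `|D|.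
      by rewrite ler_wpM2r// lerD.
    by move=> CD; lra.
  by rewrite /mu; lra.
by rewrite -ler_pdivlMl.
Qed.

(** The inverse of [T] on the image of [Q], followed by [L], is [1/r]-Lipschitz, and applying the
    inverse of [L] recovers [Q]. The set [Q] is arbitrary, so the bound can also be used to prove
    measurability. *)
Lemma lebesgue_outer_expansive L r d Q : injective T -> L \in unitmx -> 0 < r ->
  Q `<=` expansive_at L r d -> {in Q &, forall x y, `|x - y| < d} ->
  ((r ^+ n * `|\det L|)%:E * \lam Q <= \lam (T @` Q))%E.
Proof.
move=> injT Lu r0 QL Qd.
pose S z := xget 0 [set x | Q x /\ T x = z].
have ST x : Q x -> S (T x) = x.
  move=> Qx; rewrite /S; case: xgetP => [y _ [Qy /injT]//|/(_ x)[]//].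
have detL0 : 0 < `|\det L| by rewrite normr_gt0 -unitfE -unitmxE.
have rn0 : 0 < r ^+ n by rewrite exprn_gt0.
have lipS : {in T @` Q &, forall z w, `|S z *m L - S w *m L| <= r^-1 * `|z - w|}.
  move=> _ _ /set_mem[x Qx <-] /set_mem[y Qy <-]; rewrite !ST// -mulmxBl.
  by rewrite ler_pdivlMl//; apply: (QL y Qy); apply: Qd; rewrite inE.
have := lebesgue_outer_lipschitz (F := fun z => S z *m L) _ lipS (T @` Q).
rewrite invr_gt0 setIid => /(_ r0) LQ.
have QE : Q = mulmx^~ (invmx L) @` ((fun z => S z *m L) @` (T @` Q)).
  apply/seteqP; split => [x Qx|_ [_ [_ [x Qx <-] <-] <-]].
    exists (x *m L); last by rewrite mulmxK.
    by exists (T x); [exists x|rewrite ST].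
  by rewrite ST// mulmxK.
have iLu : invmx L \in unitmx by rewrite unitmx_inv.
have := scales_mulmx iLu ((fun z => S z *m L) @` (T @` Q)); rewrite -QE.
rewrite det_inv normfV => QL'.
have := le_trans QL' (lee_wpmul2l _ LQ).
rewrite lee_fin invr_ge0 normr_ge0 => /(_ isT).
rewrite muleA -EFinM exprVn -invfM mulrC => {}QL'.
have c0 : 0 < r ^+ n * `|\det L| by rewrite mulr_gt0.
have := lee_wpmul2l (_ : 0 <= (r ^+ n * `|\det L|)%:E)%E QL'.
rewrite lee_fin ltW// => /(_ isT); rewrite muleA -EFinM mulfV ?mul1e//.
by rewrite gt_eqF.
Qed.

End invertible_derivative.

(** * The area inequality *)

Section integral_bounds.
Context d (X : measurableType d) {R : realType} (mu : {measure set X -> \bar R}).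
Context (A : set X) (mA : measurable A) (f : X -> R) (mf : measurable_fun setT f).
Hypothesis f_ge0 : forall x, 0 <= f x.

Let mEf : measurable_fun A (EFin \o f).
Proof. by apply/measurable_EFinP; exact: measurable_funTS. Qed.

Lemma integral_le_cst (b : R) : (forall x, A x -> f x <= b) ->
  (\int[mu]_(x in A) (f x)%:E <= b%:E * mu A)%E.
Proof.
move=> fb; rewrite -integral_cst//; apply: ge0_le_integral => //.
by move=> x _; rewrite lee_fin.
Qed.

Lemma integral_ge_cst (b : R) : 0 <= b -> (forall x, A x -> b <= f x) ->
  (b%:E * mu A <= \int[mu]_(x in A) (f x)%:E)%E.
Proof.
move=> b0 bf; rewrite -integral_cst//; apply: ge0_le_integral => //.
Qed.

End integral_bounds.

#[local] Instance ae_lebesgue_filter (R : realType) n :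
  Filter (nbhs (almost_everywhere (@lebesgue_measure_Rn R n))).
Proof. exact: (ae_filter_ringOfSetsType (@lebesgue_measure_Rn R n)). Qed.

(** * Countable decomposition into expansive pieces *)

Section pieces.
Context {R : realType} {n : nat} (T : 'rV[R]_n -> 'rV[R]_n).
Hypotheses (lipT : locally_lipschitz T) (injT : injective T).
Variables (G h : 'rV[R]_n -> R).
Hypotheses (G_ge0 : forall x, 0 <= G x) (h_ge0 : forall x, 0 <= h x).
Hypotheses (mG : measurable_fun [set: Rn R n] (G : Rn R n -> R))
  (mh : measurable_fun [set: Rn R n] (h : Rn R n -> R)).
Variable r : R.
Hypothesis r01 : 0 < r < 1.
Let r_gt0 : 0 < r. Proof. by case/andP: r01. Qed.

(** A rational matrix, [k] for the radius [1 / (k + 1)], a rational box and a rational lower bound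
    for [h] on the image; countability allows summation over the pieces. *)
Let index : countType := ('M[rat]_n * nat * ('rV[rat]_n * 'rV[rat]_n) * rat)%type.
Implicit Types i : index.

Let lin i : 'M[R]_n := map_mx ratr i.1.1.1.
Let radius i : R := i.1.1.2.+1%:R^-1.
Let domain i : set 'rV[R]_n :=
  expansive_at T (lin i) r (radius i) `&` box (rat_box i.1.2).
Let level i : R := ratr i.2.
Let valid : set index := [set i | [/\ lin i \in unitmx, 0 < level i &
  {in domain i &, forall x y, `|x - y| < radius i}]].

(** In [r ^+ 2], one factor [r] pays for replacing [h (T x)] by a rational level, the other for
    replacing the Jacobian determinant by that of the rational matrix. *)
Definition piece i : set 'rV[R]_n :=
  domain i `&` [set x | level i <= h (T x)] `&`
  [set x | r ^+ 2 * G x <= level i * `|\det (lin i)|].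

Lemma piece_expansive i Q : valid i -> Q `<=` domain i ->
  ((r ^+ n * `|\det (lin i)|)%:E * \lam Q <= \lam (T @` Q))%E.
Proof.
move=> [Lu _ diam] QD; apply: (@lebesgue_outer_expansive _ _ _ _ _ (radius i)) => //.
  by move=> x /QD[].
by move=> x y; rewrite !inE => Qx Qy; apply: diam; rewrite inE; exact: QD.
Qed.

(** The delicate part is the preimage under [T] of a set that is only Lebesgue measurable. That set
    is a Borel set together with a null set, and inside the domain expansivity forces the preimage
    of the null set to be null. *)
Lemma measurable_piece i : valid i -> lebesgue_measurable (piece i).
Proof.
move=> vi; have [Lu a0 diam] := vi.
have cT := locally_lipschitz_continuous lipT.
have mdom : borel (domain i).
  apply: (sigma_algebra_setI sigma_algebra_borel); last exact: box_borel.
  by apply: closed_borel; exact: closed_expansive_at.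
have mY : lebesgue_measurable [set y | level i <= h y].
  have := mh measurableT (measurable_itv `[level i, +oo[); rewrite setTI.
  by congr (lebesgue_measurable _); apply/seteqP; split => x /=; rewrite in_itv/= andbT.
have mGi : lebesgue_measurable [set x | r ^+ 2 * G x <= level i * `|\det (lin i)|].
  have := mG measurableT (measurable_itv `]-oo, (r ^+ 2)^-1 * (level i * `|\det (lin i)|)]); rewrite setTI.
  congr (lebesgue_measurable _); apply/seteqP; split => x /=; rewrite in_itv/=;
    by rewrite ler_pdivlMl// exprn_gt0.
apply: caratheodory_measurable_setI => //.
have [B [bB BY YB0]] := lebesgue_inner_borel mY.
rewrite (_ : _ `&` _ = (domain i `&` T @^-1` B) `|`
    (domain i `&` T @^-1` ([set y | level i <= h y] `\` B))); last first.
  rewrite -setIUr -preimage_setU -[in LHS]/(T @^-1` [set y | level i <= h y]).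
  by rewrite setDUK.
apply: caratheodory_measurable_setU.
  apply: sub_borel_lebesgue; apply: (sigma_algebra_setI sigma_algebra_borel) => //.
  exact: borel_preimage.
apply: lebesgue_null; set Q := _ `&` _.
have : ((r ^+ n * `|\det (lin i)|)%:E * \lam Q <= 0)%E.
  rewrite -YB0; apply: le_trans (piece_expansive vi _) _; first by move=> x [].
  by apply: le_outer_measure => _ [x [_ Yx] <-].
have c0 : 0 < r ^+ n * `|\det (lin i)|.
  by rewrite mulr_gt0 ?exprn_gt0// normr_gt0 -unitfE -unitmxE.
rewrite pmule_rle0 ?lte_fin// => Q0.
by apply/eqP; rewrite eq_le Q0 outer_measure_ge0.
Qed.

(** Bound [G] above by a constant on [A], compare the measures of [A] and its image, and bound [h]
    below by the level on the image. The losses [r ^+ 2] and [r ^+ n] multiply to [r ^+ n.+2]. *)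
Lemma integral_piece i (A : set (Rn R n)) : valid i -> measurable A -> A `<=` piece i ->
  ((r ^+ n.+2)%:E * \int[@lebesgue_measure_Rn R n]_(x in A) (G x)%:E <=
   \int[@lebesgue_measure_Rn R n]_(y in T @` A) (h y)%:E)%E.
Proof.
move=> vi mA Ai; have [Lu a0 diam] := vi.
have mTA : measurable (T @` A : set (Rn R n)) by exact: lebesgue_image.
set b := `|\det (lin i)|.
have chain (I m mT J : \bar R) :
    (I <= ((r ^+ 2)^-1 * (level i * b))%:E * m)%E ->
    ((r ^+ n * b)%:E * m <= mT)%E -> ((level i)%:E * mT <= J)%E ->
    ((r ^+ n.+2)%:E * I <= J)%E.
  move=> Im mmT mTJ; have rn2 : 0 <= r ^+ n.+2 by rewrite exprn_ge0// ltW.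
  apply: le_trans (lee_wpmul2l _ Im) _; first by rewrite lee_fin.
  rewrite muleA -EFinM (_ : r ^+ n.+2 * _ = level i * (r ^+ n * b)); last first.
    rewrite -addn2 exprD -mulrA mulVKf; last by rewrite gt_eqF// exprn_gt0.
    by rewrite mulrCA.
  rewrite EFinM -muleA; apply: le_trans (lee_wpmul2l _ mmT) mTJ.
  by rewrite lee_fin ltW.
apply: (chain _ (@lebesgue_measure_Rn R n A) (@lebesgue_measure_Rn R n (T @` A))).
- apply: integral_le_cst => // x /Ai[_ /=].
  by rewrite ler_pdivlMl// exprn_gt0.
- by apply: piece_expansive => // x /Ai[[]].
- apply: integral_ge_cst => //; first exact: ltW.
  by move=> _ [x /Ai[[_ /= hx] _] <-].
Qed.


(** Positivity of [G x] makes both [h (T x)] and the determinant positive, so the derivative is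
    invertible and can be approximated by a rational matrix. *)
Lemma piece_cover x : 0 < G x -> G x <= h (T x) * abs_det_deriv T x ->
  exists2 i, valid i & piece i x.
Proof.
rewrite /abs_det_deriv => Gx Gh.
have hd0 : 0 < h (T x) * `|\det (jacobian T x)| := lt_le_trans Gx Gh.
have d0 : 0 < `|\det (jacobian T x)|.
  rewrite lt0r normr_ge0 andbT; apply/eqP => d0.
  by move: hd0; rewrite d0 mulr0 ltxx.
have h0 : 0 < h (T x) by move: hd0; rewrite pmulr_lgt0.
have Ju : jacobian T x \in unitmx by rewrite unitmxE unitfE -normr_gt0.
have [L [k [Lu detL xL]]] := rat_expansive_at r01 Ju.
have [a] : exists a : rat, ratr a \in `]r * h (T x), h (T x)[.
  by apply: rat_in_itvoo; rewrite gtr_pMl//; case/andP: r01.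
rewrite in_itv/= => /andP[ra ah].
(* Half the radius, so that any two points of the box are closer than the radius. *)
have k0 : 0 < k.+1%:R^-1 / 2 :> R by rewrite divr_gt0// invr_gt0.
have [q [xq qU]] := nbhs_rat_box (nbhsx_ballx x _ k0).
exists (L, k, q, a).
  split=> //=; first by apply: lt_trans ra; rewrite mulr_gt0.
  move=> y z; rewrite !inE => -[_ /sub_box_closed_box/qU xy] [_ /sub_box_closed_box/qU xz].
  move: xy xz; rewrite !mx_norm_ball /ball_/= distrC => xy xz.
  rewrite /radius/=; apply: le_lt_trans (ler_distD x y z) _.
  by rewrite [ltRHS]splitr; exact: ltrD.
split; first by split; [split|exact: ltW].
rewrite /= /level/lin/=; apply: le_trans (ler_wpM2l _ Gh) _.
  by rewrite exprn_ge0// ltW.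
rewrite (_ : r ^+ 2 * _ = (r * h (T x)) * (r * `|\det (jacobian T x)|)); last by ring.
apply: ler_pM => //; last exact: ltW.
  by apply: mulr_ge0; exact: ltW.
by apply: mulr_ge0 => //; exact: ltW.
Qed.

Lemma expansive_integral_le : 
  {ae @lebesgue_measure_Rn R n, forall x, G x <= h (T x) * abs_det_deriv T x} ->
  ((r ^+ n.+2)%:E * \int[@lebesgue_measure_Rn R n]_x (G x)%:E <=
   \int[@lebesgue_measure_Rn R n]_y (h y)%:E)%E.
Proof.
move=> aeG; pose mu := @lebesgue_measure_Rn R n.
(* Numbers that do not code a valid index give the empty set; [seqDU] then makes the pieces
   disjoint. *)
pose M k : set (Rn R n) :=
  if @unpickle index k is Some i then (if pselect (valid i) then piece i else set0) else set0.
pose A := seqDU M.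
have mM : forall k, measurable (M k).
  move=> k; rewrite /M; case: unpickle => // i; case: pselect => vi //=.
  exact: measurable_piece.
have mA : forall j, measurable (A j : set (Rn R n)).
  exact: (seqDU_measurable mM).
have mTA : forall j, measurable (T @` A j : set (Rn R n)).
  by move=> j; exact: (lebesgue_image lipT injT (mA j)).
have mUA : measurable (\bigcup_k A k) := bigcup_measurable (fun k _ => mA k).
have mUTA : measurable (\bigcup_k (T @` A k : set (Rn R n))) :=
  bigcup_measurable (fun k _ => mTA k).
have mEG : measurable_fun [set: Rn R n] (EFin \o (G : Rn R n -> R)) by exact/measurable_EFinP.
have mEh : measurable_fun [set: Rn R n] (EFin \o (h : Rn R n -> R)) by exact/measurable_EFinP.
have A_le k : ((r ^+ n.+2)%:E * \int[mu]_(x in A k) (G x)%:E <=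
    \int[mu]_(y in T @` A k) (h y)%:E)%E.
  have AM : A k `<=` M k by exact: subset_seqDU.
  have [[i [vi Mi]]|Mk0] : (exists i, valid i /\ M k = piece i) \/ M k = set0.
  - rewrite /M; case: unpickle => [i|]; last by right.
    by case: pselect => [vi|]; [left; exists i|right].
  - by apply: (integral_piece vi) => //; rewrite -Mi.
  have -> : A k = set0 by rewrite -subset0 -Mk0.
  by rewrite image_set0 !integral_set0 mule0.
(* Almost every point outside the pieces has [G x = 0]. *)
have GA : (\int[mu]_x (G x)%:E <= \int[mu]_(x in \bigcup_k A k) (G x)%:E)%E.
  rewrite [leRHS]integral_mkcond; apply: ae_ge0_le_integral => //.
  - by move=> x _; rewrite lee_fin.
  - by move=> x _; rewrite patchE; case: ifP => // _; rewrite lee_fin.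
  - by apply/(measurable_restrictT _ mUA); exact: measurable_funTS.
  apply: filterS aeG => x Gx _; rewrite patchE; case: ifPn => // /negP nA.
  rewrite lee_fin leNgt; apply/negP => G0; apply: nA.
  rewrite inE -seqDU_bigcup_eq; have [i vi ix] := piece_cover G0 Gx.
  exists (pickle i); first exact: I.
  by rewrite /M pickleK; case: pselect => [v|nv]; [exact: ix|case: (nv vi)].
have r0 : 0 <= r ^+ n.+2 by rewrite exprn_ge0// ltW.
apply: le_trans (lee_wpmul2l _ GA) _; first by rewrite lee_fin.
rewrite ge0_integral_bigcup//; last 3 first.
- exact: measurable_funTS.
- by move=> x _; rewrite lee_fin.
- exact: trivIset_seqDU.
rewrite -nneseriesZl; last by move=> k _; apply: integral_ge0 => x _; rewrite lee_fin.
apply: (@le_trans _ _ (\sum_(0 <= k <oo) \int[mu]_(y in T @` A k) (h y)%:E)%E).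
  apply: lee_nneseries => [k _ _|k _]; last exact: A_le.
  by rewrite mule_ge0// integral_ge0// => x _; rewrite lee_fin.
rewrite -ge0_integral_bigcup//.
- apply: ge0_subset_integral => //.
  by move=> x _; rewrite lee_fin.
- exact: measurable_funTS.
- by move=> x _; rewrite lee_fin.
apply/trivIsetP => j k _ _ jk; rewrite -subset0 => _ [[x Ax <-] [y Ay /injT yx]].
have /trivIsetP/(_ j k I I jk) := trivIset_seqDU M.
rewrite -subset0 => /(_ x); apply; split; first exact: Ax.
by rewrite -yx.
Qed.

End pieces.

(** * The limit in [r], and the change of exponent *)

Lemma integral_le_change_of_variables (R : realType) (n : nat)
    (T : 'rV[R]_n -> 'rV[R]_n) (G h : 'rV[R]_n -> R) :
  locally_lipschitz T -> injective T ->
  (forall x, 0 <= G x) -> (forall x, 0 <= h x) ->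
  measurable_fun [set: Rn R n] (G : Rn R n -> R) ->
  measurable_fun [set: Rn R n] (h : Rn R n -> R) ->
  {ae @lebesgue_measure_Rn R n, forall x, G x <= h (T x) * abs_det_deriv T x} ->
  (\int[@lebesgue_measure_Rn R n]_x (G x)%:E <=
   \int[@lebesgue_measure_Rn R n]_y (h y)%:E)%E.
Proof.
move=> lipT injT G0 h0 mG mh aeG.
apply/lee_mul01Pr; first by apply: integral_ge0 => x _; rewrite lee_fin.
move=> rho /andP[rho0 rho1].
(* With this root, the loss [r ^+ n.+2] is an arbitrary factor [rho] in ]0, 1[, which may tend to
   1. *)
pose r := rho `^ n.+2%:R^-1.
have -> : rho = r ^+ n.+2.
  by rewrite /r -powR_mulrn ?powR_ge0// -powRrM mulVf// powRr1// ltW.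
apply: expansive_integral_le => //; apply/andP; split; first exact: powR_gt0.
have /gt0_ltr_powR/(_ rho 1) : 0 < n.+2%:R^-1 :> R by rewrite invr_gt0.
by rewrite !nnegrE ler01 ltW// powR1; exact.
Qed.

(** Raising the hypothesis to the power [s / s0 >= 1] gives [b^s d^(s / s0)] on the right, and
    [d^(s / s0) <= d] because [d] lies in [0, 1]. *)
Lemma powR_le_mulr (R : realType) (a b d s0 s : R) :
  0 <= d <= 1 -> 0 < s0 -> s0 <= s -> a `^ s0 = b `^ s0 * d ->
  a `^ s <= b `^ s * d.
Proof.
move=> /andP[d0 d1] s00 s0s ab.
have powRs (u : R) : u `^ s = (u `^ s0) `^ (s / s0).
  by rewrite -powRrM mulrCA mulfV ?mulr1// gt_eqF.
rewrite powRs ab powRM ?powR_ge0// -powRs; apply: ler_wpM2l; first exact: powR_ge0.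
have s1 : 1 <= s / s0 by rewrite ler_pdivlMr// mul1r.
have [->|dN0] := eqVneq d 0.
  by rewrite powR0// gt_eqF// (lt_le_trans ltr01).
by rewrite -[leRHS]powRr1// ger_powR// lt0r dN0 d0.
Qed.

Unset Implicit Arguments.
Set Strict Implicit.

Theorem lemma1p6 (R : realType) (n : nat) (f g : 'rV[R]_n -> R)
  (f_ge0 : forall x, 0 <= f x) (g_ge0 : forall x, 0 <= g x)
  (mf : measurable_fun [set: Rn R n] (f : Rn R n -> R))
  (mg : measurable_fun [set: Rn R n] (g : Rn R n -> R))
  (s0 : R) (s0_gt0 : 0 < s0) (T : 'rV[R]_n -> 'rV[R]_n)
  (cvT : change_of_variables (fun x => g x `^ s0) (fun x => f x `^ s0) T)
  (detT : {ae @lebesgue_measure_Rn R n, forall x, abs_det_deriv T x <= 1})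
  (int_eq : (\int[@lebesgue_measure_Rn R n]_x (g x `^ s0)%:E =
             \int[@lebesgue_measure_Rn R n]_x (f x `^ s0)%:E)%E)
  (int_fin : (\int[@lebesgue_measure_Rn R n]_x (f x `^ s0)%:E < +oo)%E)
  (s : R) (s0_le_s : s0 <= s) :
  (\int[@lebesgue_measure_Rn R n]_x (g x `^ s)%:E <=
   \int[@lebesgue_measure_Rn R n]_x (f x `^ s)%:E)%E.
Proof.
have [lipT injT aeT] := cvT.
apply: (integral_le_change_of_variables lipT injT).
- by move=> x; exact: powR_ge0.
- by move=> x; exact: powR_ge0.
- exact: (measurableT_comp (measurable_powR s) mg).
- exact: (measurableT_comp (measurable_powR s) mf).
apply: filterS2 aeT detT => x gx dx.
apply: (@powR_le_mulr _ _ _ _ s0) => //.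
by apply/andP; split; [exact: normr_ge0|exact: dx].
Qed.
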